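(* Let $A$ be a finite abelian group and $Z$ a subgroup of $A$. For any $\phi\in\mathrm{Irr}(Z)$, $\mu_\phi(A)=1$.
   Context: Let $G$ be a finite group. $\mathrm{Irr}$ denotes the set of irreducible complex characters, $\mathrm{Conj}(G)$ the set of conjugacy classes of $G$, and $C_G(g)$ the centralizer of $g$. The group algebra $\mathbb{C}G$ has basis $\{[g]\mid g\in G\}$ with $[g][h]=[gh]$; $[S]=\sum_{g\in S}[g]$ for $S\subset G$; $Z(\mathbb{C}G)$ is its center. Let $\overline{\sum_g c_g[g]}=\sum_g\overline{c_g}[g^{-1}]$, and for $u,v\in Z(\mathbb{C}G)$ let $\langle u|v\rangle=\mathrm{tr}_{Z(\mathbb{C}G)}(\overline{u}v)$, where $\mathrm{tr}_{Z(\mathbb{C}G)}(u)$ is the trace of $w\mapsto uw$ on $Z(\mathbb{C}G)$. For a finite ordered set $\mathcal{B}\subset Z(\mathbb{C}G)$ put $\gamma(\mathcal{B})=|\det(\langle u|v\rangle)_{u,v\in\mathcal{B}}|$. Let $Z$ be a subgroup of the center of $G$. $Z$ acts on $\mathrm{Conj}(G)$ by $(z,K)\mapsto zK$. The $Z$-orbits are indexed by the classes of $G/Z$: write $\mathrm{Conj}(G/Z)=\{\overline{K}_i\mid i\in I_{G/Z}\}$, choose $g_i\in G$ whose image in $G/Z$ lies in $\overline{K}_i$, and let $K_i$ be the conjugacy class of $g_i$ in $G$; then $\{K_i\mid i\in I_{G/Z}\}$ is a complete set of representatives of the $Z$-orbits in $\mathrm{Conj}(G)$. For $K\in\mathrm{Conj}(G)$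 let $\mathrm{Ann}_Z(K)=\{z\in Z\mid zK=K\}$, and for $N\le Z$ let $I(G:Z)_N=\{j\in I_{G/Z}\mid\mathrm{Ann}_Z(K_j)=N\}$. For $\phi\in\mathrm{Irr}(Z)$ put $e_\phi=\frac{1}{|Z|}\sum_{z\in Z}\overline{\phi(z)}[z]$, $\mathcal{B}(G)_\phi=\{e_\phi[K_j]\mid X\le\mathrm{Ker}\,\phi,\ j\in I(G:Z)_X\}$, $\gamma_\phi(G)=\gamma(\mathcal{B}(G)_\phi)$, $c_\phi(G)=\prod_{N\le\mathrm{Ker}\,\phi}\prod_{j\in I(G:Z)_N}|C_G(g_j)|\,|Z/N|^{-1}$, and $\mu_\phi(G)=\gamma_\phi(G)/c_\phi(G)$. (These numbers do not depend on the choices of the $g_i$.) In the claim this is applied with $G=A$. *)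

(* Defs.v *)
From mathcomp Require Import all_boot all_order all_algebra all_fingroup.
From mathcomp Require Import all_solvable all_field all_character.

Set Implicit Arguments.
Unset Strict Implicit.
Unset Printing Implicit Defensive.

Import GroupScope Order.TTheory GRing.Theory Num.Theory.
Local Open Scope ring_scope.

(* The group algebra CG is MathComp's group_ring algC G: the algebra of       *)
(* #|G| x #|G| matrices spanned by the (linearly independent) matrices of the *)
(* regular representation. An element of CG is thus a matrix, its product is  *)
(* *m, and [S] is gset_mx algC G S = \sum_(x in S) [x].                       *)

Section GroupAlgebra.

Variables (gT : finGroupType) (G : {group gT}).

Definition gbasis (x : gT) : 'M[algC]_#|G| := regular_repr algC G x.

(* gring_row u lists the coordinates of u in the basis ([g])_(g in G) *)
Definition gcoef (u : 'M[algC]_#|G|) (x : gT) : algC :=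
  gring_row u 0 (gring_index G x).

Definition gbar (u : 'M[algC]_#|G|) : 'M[algC]_#|G| :=
  \sum_(x in G) (gcoef u x)^* *: gbasis x^-1%g.

Definition Zgroup_ring := center_mx (group_ring algC G).

(* the trace of w |-> u w on the center; restrictmx gives the matrix of this  *)
(* endomorphism in a basis of the center                                      *)
Definition trZ (u : 'M[algC]_#|G|) : algC :=
  \tr (restrictmx Zgroup_ring (lin_mulmx u)).

Definition gform (u v : 'M[algC]_#|G|) : algC := trZ (gbar u *m v).

(* s enumerates a finite ordered set, so it should be duplicate-free *)
Definition gram_gamma (s : seq 'M[algC]_#|G|) : algC :=
  `| \det (\matrix_(i < size s, j < size s) gform s`_i s`_j) |.

End GroupAlgebra.

Section CentralSubgroup.

Variables (gT : finGroupType) (G Z : {group gT}).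

Definition AnnZ (K : {set gT}) : {set gT} := [set z in Z | z *: K == K]%g.

(* The index set I_{G/Z} is classes (G / Z) itself; g picks, for each class   *)
(* of G / Z, an element of G whose image lies in that class.                  *)
Definition class_choice (g : {set coset_of Z} -> gT) : Prop :=
  forall j, j \in classes (G / Z) -> g j \in G /\ coset Z (g j) \in j.

Variable g : {set coset_of Z} -> gT.

Definition Kcl (j : {set coset_of Z}) : {set gT} := (g j ^: G)%g.

Definition Iann (N : {set gT}) : {set {set coset_of Z}} :=
  [set j in classes (G / Z) | AnnZ (Kcl j) == N].

Variable phi : 'CF(Z).

Definition ephi : 'M[algC]_#|G| :=
  #|Z|%:R^-1 *: \sum_(z in Z) (phi z)^* *: gbasis G z.

Definition Bphi : seq 'M[algC]_#|G| :=
  undup [seq ephi *m gset_mx algC G (Kcl j)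
        | X : {group gT} <- enum (subgroups (cfker phi)), j <- enum (Iann X)].

Definition gamma_phi : algC := gram_gamma Bphi.

Definition c_phi : algC :=
  \prod_(N in subgroups (cfker phi)) \prod_(j in Iann N)
    (#|'C_G[g j]|%:R / #|(Z / N)%g|%:R).

Definition mu_phi : algC := gamma_phi / c_phi.

End CentralSubgroup.

(* Main.v *)
Require Import Defs.
From mathcomp Require Import all_boot all_order all_algebra all_fingroup.
From mathcomp Require Import all_solvable all_field all_character.

Import GroupScope Order.TTheory GRing.Theory Num.Theory.
Local Open Scope ring_scope.

(** Since A is abelian, its group algebra is its own center, and multiplication
    by u in a basis of group elements has the matrix u itself, read in the
    regular representation; so the trace form of the center is the trace of the
    regular representation, which sends [x] to |A| if x = 1 and to 0 otherwise
    (trZ_abelian, gform_sum). Translates of e_phi by elements of different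
    Z-cosets have disjoint supports, so they are orthogonal. The norm of one
    translate is |A| / |Z|^2 times the sum of |phi z|^2 over Z, that is
    |A| / |Z|, because irreducible characters have norm 1 (gform_ephi).

    A class of A is a singleton, so only z = 1 fixes it: the only annihilator
    is the trivial group, which lies in every kernel. Hence B_phi consists of
    one translate of e_phi for each element of A / Z, its Gram matrix is scalar,
    and gamma_phi is |A| / |Z| to the power |A / Z|. The number c_phi is a
    product over the same indices, of factors |A| / |Z|, so the quotient is 1
    (gamma_phi_abelian, c_phi_abelian). *)

Set Implicit Arguments.
Unset Strict Implicit.

(** A trace does not depend on the basis in which it is taken. The basis B may
    have a number of rows p that differs from the rank of V as an expression,
    so the change of basis goes through a pair of rectangular matrices and
    cyclicity of the trace. *)
Lemma mxtrace_restrictmx (F : fieldType) (m p n : nat) (V : 'M[F]_(m, n))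
    (B : 'M[F]_(p, n)) (f : 'M[F]_n) (M : 'M[F]_p) :
  row_free B -> (V == B)%MS -> B *m f = M *m B -> \tr (restrictmx V f) = \tr M.
Proof.
move=> freeB /eqmxP eqVB defM; set R := row_base V.
have sRB : (R <= B)%MS by rewrite eq_row_base eqVB.
have sBR : (B <= R)%MS by rewrite eq_row_base eqVB.
have -> : conjmx R f = (R *m pinvmx B) *m (M *m (B *m pinvmx R)).
  by rewrite mulmxA mulmxA -(mulmxA _ M B) -defM mulmxA (mulmxKpV sRB).
rewrite mxtrace_mulC -mulmxA [B *m _ *m _]mulmxA (mulmxKpV sBR).
by rewrite mulmxVp ?mulmx1.
Qed.

Section GroupAlgebra.

Variables (gT : finGroupType) (G : {group gT}).

(** The trace of a permutation matrix counts fixed points, and multiplication by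
    x has none unless x = 1. *)
Lemma mxtrace_gbasis x : x \in G -> \tr (gbasis G x) = #|G|%:R *+ (x == 1%g).
Proof.
by move=> Gx; have := cfRegE G x; rewrite -cfReprReg cfunE Gx mulr1n.
Qed.

Lemma gcoef_gbasis x y :
  x \in G -> y \in G -> gcoef (G := G) (gbasis G y) x = (x == y)%:R.
Proof.
move=> Gx Gy; rewrite /gcoef /gring_row /gbasis rowK mxE gring_indexK // mul1g.
by rewrite eqxx /= -(inj_eq enum_val_inj) !gring_indexK.
Qed.

(** The bar involution is conjugate-linear and may be computed on any expression
    of an element by group elements, repetitions among the h i included. *)
Lemma gbar_sum (I : finType) (P : pred I) (c : I -> algC) (h : I -> gT) :
  (forall i, P i -> h i \in G) ->
  gbar (\sum_(i | P i) c i *: gbasis G (h i))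
    = \sum_(i | P i) (c i)^* *: gbasis G (h i)^-1%g.
Proof.
move=> Gh; rewrite /gbar.
have coefE x : x \in G -> gcoef (\sum_(i | P i) c i *: gbasis G (h i)) x
    = \sum_(i | P i) c i * (x == h i)%:R.
  move=> Gx; rewrite /gcoef linear_sum summxE; apply: eq_bigr => i Pi.
  by rewrite linearZ mxE -(gcoef_gbasis Gx) // Gh.
under eq_bigr => x Gx do rewrite coefE // rmorph_sum scaler_suml.
rewrite exchange_big; apply: eq_bigr => i Pi.
rewrite (bigD1 (h i)) ?Gh //= eqxx mulr1 big1 ?addr0 // => x /andP[_ /negPf ->].
by rewrite mulr0 rmorph0 scale0r.
Qed.

Hypothesis abG : abelian G.

Lemma group_ring_comm u v : (u \in group_ring algC G)%MS ->
  (v \in group_ring algC G)%MS -> u *m v = v *m u.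
Proof.
move=> /envelop_mxP[a ->] /envelop_mxP[b ->].
rewrite mulmx_suml mulmx_sumr; apply: eq_bigr => x Gx.
rewrite mulmx_sumr mulmx_suml; apply: eq_bigr => y Gy.
rewrite -!scalemxAl -!scalemxAr scalerA scalerA mulrC -!repr_mxM //.
by rewrite (centsP abG x Gx y Gy).
Qed.

(** As the group ring R is commutative, it equals its center, whose basis may
    be taken to be that of R. In that basis left multiplication by u is right
    multiplication, whose matrix is u. *)
Lemma trZ_abelian u : (u \in group_ring algC G)%MS -> trZ u = \tr u.
Proof.
move=> Ru; apply: (@mxtrace_restrictmx _ _ _ _ _ (group_ring algC G)).
- exact: gring_free.
- apply/andP; split; first exact: center_mx_sub.
  apply/memmx_subP => v Rv; apply/center_mxP; split=> // w Rw.
  exact: group_ring_comm.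
apply/row_matrixP => i; rewrite !row_mul rowK mul_vec_lin /=.
(* With x the i-th element of G, row i of u lists the coordinates of [x] *m u,
   because coordinates of [x] are the i-th unit vector and the coordinate map
   commutes with right multiplication; the left side is u *m [x]. *)
rewrite group_ring_comm ?envelop_mx_id ?enum_valP // -[RHS]vec_mxK.
have := gring_mxA (regular_repr algC G) (delta_mx 0 i) (gring_row u).
rewrite gring_rowK // /gring_mx /= -!rowE rowK mxvecK => ->.
by rewrite group_ring_comm ?envelop_mx_id ?enum_valP.
Qed.

(** On the basis of group elements the form is |G| times the standard Hermitian
    form. *)
Lemma gform_sum (I : finType) (P : pred I) (c d : I -> algC) (h k : I -> gT) :
  (forall i, P i -> h i \in G) -> (forall i, P i -> k i \in G) ->
  gform (\sum_(i | P i) c i *: gbasis G (h i))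
        (\sum_(i | P i) d i *: gbasis G (k i))
    = #|G|%:R * \sum_(i | P i) \sum_(j | P j) (c i)^* * d j * (h i == k j)%:R.
Proof.
move=> Gh Gk; rewrite /gform gbar_sum // trZ_abelian; last first.
  rewrite envelop_mxM ?linear_sum ?summx_sub // => i Pi.
    by rewrite linearZ scalemx_sub ?envelop_mx_id ?groupV ?Gh.
  by rewrite linearZ scalemx_sub ?envelop_mx_id ?Gk.
rewrite mulmx_suml linear_sum mulr_sumr; apply: eq_bigr => i Pi.
rewrite mulmx_sumr linear_sum mulr_sumr; apply: eq_bigr => j Pj.
have Ghi : (h i)^-1%g \in G by rewrite groupV Gh.
have Gkj := Gk j Pj.
rewrite -scalemxAl -scalemxAr scalerA linearZ -repr_mxM //=.
rewrite mxtrace_gbasis ?groupM //.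
by rewrite -eq_mulVg1 [RHS]mulrCA mulr_natr.
Qed.

End GroupAlgebra.

Lemma gram_gamma_orthogonal (gT : finGroupType) (G : {group gT}) (c : algC)
    (s : seq 'M[algC]_#|G|) :
  uniq s -> {in s &, forall u v, gform u v = c *+ (u == v)} ->
  gram_gamma s = `|c| ^+ size s.
Proof.
move=> uniq_s orth_s; rewrite /gram_gamma -normrX -det_scalar.
congr (`|\det _|).
by apply/matrixP => i j; rewrite !mxE orth_s ?mem_nth // nth_uniq.
Qed.

Section AbelianGroup.

Variables (gT : finGroupType) (A Z : {group gT}).
Hypotheses (abA : abelian A) (sZA : Z \subset A).

Lemma ephi_gbasis (phi : 'CF(Z)) x : x \in A ->
  ephi A phi *m gbasis A x
    = \sum_(z in Z) (#|Z|%:R^-1 * (phi z)^*) *: gbasis A (z * x)%g.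
Proof.
move=> Ax; rewrite /ephi scaler_sumr mulmx_suml; apply: eq_bigr => z Zz.
by rewrite scalerA -scalemxAl -repr_mxM // (subsetP sZA).
Qed.

(** The hypothesis on x and y is what two representatives of Z-cosets satisfy,
    equal or not. *)
Lemma gform_ephi (phi : 'CF(Z)) (x y : gT) :
    phi \in irr Z -> x \in A -> y \in A -> (coset Z x = coset Z y -> x = y) ->
  gform (ephi A phi *m gbasis A x) (ephi A phi *m gbasis A y)
    = (#|A|%:R / #|Z|%:R) *+ (x == y).
Proof.
move=> irr_phi Ax Ay inj_xy.
rewrite !ephi_gbasis // gform_sum // => [|z Zz|z Zz]; last 2 first.
- by rewrite groupM // (subsetP sZA).
- by rewrite groupM // (subsetP sZA).
have [<- | neq_xy] := eqVneq x y; last first.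
  (* z * x = w * y with z, w in Z would put x and y in the same coset. *)
  rewrite big1 ?mulr0 // => z Zz; rewrite big1 // => w Zw.
  case: eqP => [eq_zw|_]; last by rewrite mulr0.
  case/eqP: neq_xy; apply: inj_xy.
  by rewrite -(coset_kerl x Zz) eq_zw coset_kerl.
case/irrP: irr_phi => i ->; have := cfnorm_irr i; rewrite cfdotE => norm1.
rewrite mulr1n; congr (_ * _).
rewrite -[RHS]mulr1 -[X in _ = _ * X]norm1 !mulr_sumr.
apply: eq_bigr => z Zz; rewrite (bigD1 z) //= eqxx mulr1 big1 ?addr0.
  by rewrite rmorphM /= conjCK fmorphV rmorph_nat mulrACA -mulrA.
move=> w /andP[_ neq_wz].
by rewrite (inj_eq (mulIg x)) eq_sym (negPf neq_wz) mulr0.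
Qed.

Variable g : {set coset_of Z} -> gT.
Hypothesis g_choice : class_choice A g.

Lemma Kcl_abelian j : j \in classes (A / Z) -> Kcl A g j = [set g j].
Proof.
move=> /g_choice[Agj _]; apply/cent_classP; exact: (subsetP abA).
Qed.

Lemma class_choice_inj j k : j \in classes (A / Z) -> k \in classes (A / Z) ->
  coset Z (g j) = coset Z (g k) -> j = k.
Proof.
move=> clj clk eq_jk.
have classE i : i \in classes (A / Z) -> i = coset Z (g i) ^: (A / Z).
  move=> cli; have [_ gi] := g_choice cli; case/imsetP: (cli) => x _ def_i.
  rewrite {1}def_i; apply/esym/class_eqP; rewrite -def_i; exact: gi.
by rewrite (classE j clj) (classE k clk) eq_jk.
Qed.

(** Multiplication by z fixes a singleton class only if z = 1, so every class
    has trivial annihilator. *)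
Lemma Iann_abelian (N : {set gT}) :
  Iann A g N = if N == 1%g then classes (A / Z) else set0.
Proof.
apply/setP => j; rewrite inE.
have [clj | nclj] := boolP (j \in classes (A / Z)); last first.
  by case: ifP => _; rewrite ?inE ?(negPf nclj).
have -> : AnnZ Z (Kcl A g j) = 1%g.
  apply/setP=> z; rewrite !inE Kcl_abelian // mulg_set1 (inj_eq set1_inj).
  rewrite -{2}[g j]mul1g (inj_eq (mulIg _)) andbC.
  by case: eqP => // ->; rewrite group1.
by rewrite eq_sym; case: ifP; rewrite ?inE ?clj.
Qed.

Lemma c_phi_abelian (phi : 'CF(Z)) :
  c_phi A g phi = (#|A|%:R / #|Z|%:R) ^+ #|classes (A / Z)|.
Proof.
rewrite /c_phi (bigD1 1%G) ?inE ?sub1G //=.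
rewrite [X in _ * X]big1 => [|N /andP[_ ntN]].
  rewrite mulr1 Iann_abelian eqxx -prodr_const; apply: eq_bigr => j clj.
  have [Agj _] := g_choice clj; congr (_%:R / _%:R).
    by congr #|pred_of_set _|; apply/setIidPl; rewrite sub_cent1 (subsetP abA).
  by rewrite card_quotient ?indexg1 ?norms1.
by rewrite Iann_abelian ifN ?big_set0.
Qed.

(** B_phi is an orthogonal family of vectors of square norm |A| / |Z|. That norm
    is nonzero, so distinct indices give distinct vectors and B_phi has as many
    elements as A / Z has classes. *)
Lemma gamma_phi_abelian (phi : 'CF(Z)) : phi \in irr Z ->
  gamma_phi A g phi = (#|A|%:R / #|Z|%:R) ^+ #|classes (A / Z)|.
Proof.
move=> irr_phi; set b := fun j => ephi A phi *m gbasis A (g j).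
have c_gt0 : 0 < #|A|%:R / #|Z|%:R :> algC.
  by rewrite divr_gt0 ?ltr0n ?cardG_gt0.
have formb : {in classes (A / Z) &, forall j k,
    gform (b j) (b k) = (#|A|%:R / #|Z|%:R) *+ (j == k)}.
  move=> j k clj clk; have [Agj _] := g_choice clj.
  have [Agk _] := g_choice clk; rewrite gform_ephi //.
    congr (_ *+ nat_of_bool _); apply/eqP/eqP => [eq_g | -> //].
    by apply: class_choice_inj => //; rewrite eq_g.
  by move=> /(class_choice_inj clj clk) ->.
have injb : {in classes (A / Z) &, injective b}.
  move=> j k clj clk eqb; apply/eqP; move: (formb _ _ clj clk).
  rewrite -eqb formb // eqxx; case: eqP => // _ /eqP.
  by rewrite mulr0n mulr1n gt_eqF.
have memB : Bphi A g phi =i [seq b j | j in classes (A / Z)].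
  move=> u; rewrite mem_undup; apply/allpairsPdep/imageP.
    case=> X [j [_]]; rewrite mem_enum Iann_abelian.
    case: ifP => [_ clj ->|]; last by rewrite in_set0.
    exists j => //.
    by rewrite Kcl_abelian // /gset_mx big_set1.
  case=> j clj ->; exists 1%G, j; rewrite !mem_enum Iann_abelian eqxx inE sub1G.
  by split=> //; rewrite Kcl_abelian // /gset_mx big_set1.
have uniqB : uniq (Bphi A g phi) by exact: undup_uniq.
rewrite /gamma_phi (@gram_gamma_orthogonal _ _ (#|A|%:R / #|Z|%:R)) //.
  rewrite gtr0_norm //; congr (_ ^+ _).
  rewrite (perm_size (uniq_perm uniqB _ memB)) ?size_image //.
  by apply/dinjectiveP => j k; apply: injb.
move=> u v; rewrite !memB => /imageP[j clj ->] /imageP[k clk ->].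
by rewrite formb // (inj_in_eq injb).
Qed.

End AbelianGroup.

Unset Implicit Arguments.
Set Strict Implicit.

Theorem proposition4p1 (gT : finGroupType) (A Z : {group gT})
  (abA : abelian A) (sZA : Z \subset A)
  (g : {set coset_of Z} -> gT) (g_choice : class_choice A g)
  (phi : 'CF(Z)) (phi_irr : phi \in irr Z) :
  mu_phi A g phi = 1.
Proof.
rewrite /mu_phi gamma_phi_abelian // c_phi_abelian // divff // expf_neq0 //.
by rewrite mulf_neq0 ?invr_eq0 ?neq0CG.
Qed.
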